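(* Let $H>0$ and $R\in(0,\pi)$. For $0\le h\le H$ and $0\le\theta_0\le R$ let $u_{h,\theta_0}$ be the rotationally symmetric function on $\Omega_R=\{\Psi(\theta,\phi):0\le\theta\le R\}$ given by $$u_{h,\theta_0}(\theta)=\begin{cases}h,&\theta\in[0,\theta_0],\\ \frac{h}{R-\theta_0}(R-\theta),&\theta\in(\theta_0,R],\end{cases}$$ (with $u_{h,R}\equiv h$), and let $g(\theta_0)=R_2[u_{H,\theta_0}]$, i.e. for $\theta_0<R$, with $K=H/(R-\theta_0)$, $$g(\theta_0)=2\pi e^{-2H}(1-\cos\theta_0)+\frac{2\pi}{1+K^2}\int_{\theta_0}^R e^{-2K(R-\theta)}\sin\theta\,d\theta .$$ Then the function $(h,\theta_0)\mapsto R_2[u_{h,\theta_0}]$ on $[0,H]\times[0,R]$ attains its minimum at a unique point $(H,\theta_0^* )$, where $\theta_0^*$ is the unique solution in $(0,R)$ of $g'(\theta_0)=0$.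
   Context: Spherical coordinates $\Psi(\theta,\phi)=(\sin\theta\cos\phi,\sin\theta\sin\phi,\cos\theta)$ on $\mathbb{S}^2$. For $u$ on a domain $\Omega\subset\mathbb{S}^2$, $R_2[u]=\int_\Omega\frac{e^{-2u}}{1+|\nabla_{\mathbb{S}^2}u|^2}d\Omega$; for rotationally symmetric $u=u(\theta)$ on $\Omega_R$ this equals $2\pi\int_0^R\frac{e^{-2u(\theta)}\sin\theta}{1+u'(\theta)^2}d\theta$. The graphs of the $u_{h,\theta_0}$ are called radial frustum cones. *)

(* Defs.v *)
From Stdlib Require Import Reals.
From Coquelicot Require Import Coquelicot.
Open Scope R_scope.

Definition u_cone (Rr h t0 : R) (th : R) : R :=
  if Rle_dec th t0 then h else h / (Rr - t0) * (Rr - th).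

(* R_2[u] for a rotationally symmetric u = u(theta) on Omega_Rr:
   2 pi int_0^Rr e^{-2u} sin theta / (1 + u'(theta)^2) dtheta. *)
Definition R2_sym (Rr : R) (u : R -> R) : R :=
  2 * PI * RInt (fun th => exp (-2 * u th) * sin th / (1 + (Derive u th) ^ 2)) 0 Rr.

Definition g_fun (Rr H : R) (t0 : R) : R := R2_sym Rr (u_cone Rr H t0).

(* Main.v *)
Require Import Defs.
From Stdlib Require Import Reals Lra.
From Coquelicot Require Import Coquelicot.
Open Scope R_scope.

(** For fixed [t0] the functional strictly decreases in [h], so a minimiser has [h = H].
    In terms of the slant width [L = Rr - t0], integration by parts shows that [dg/dL] is a
    positive multiple of
      [G(L) = 2 int_0^1 e^(-2Hs) (L^2 s / H + L^2 / (L^2 + H^2)) sin(Rr - L s) ds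
              - e^(-2H) sin(Rr - L)],
    with [G(0) < 0 < G(Rr)].  [G] need not be monotone, but it changes sign only once:
    [(1 + H^2 / L^2) G] increases while [Rr - L >= PI / 2], by concavity of the sine, and
    [G / sin (Rr - L)] increases while [Rr - L <= PI / 2], because there
    [sin(Rr - L s) / sin(Rr - L)] is nondecreasing in [L].  The zero of [G] gives the
    minimiser and the only critical point. *)

(** * Preliminaries on the sine and on integrals of differentiable functions *)

(** Concavity of the sine on [[0, PI]] with [sin 0 = 0]: the difference of the two sides has
    derivative [l * (cos (l * y) - cos y)], nonnegative because the cosine decreases there. *)
Lemma sin_scale_ge (l x : R) : 0 <= l <= 1 -> 0 <= x <= PI -> l * sin x <= sin (l * x).
Proof.
intros Hl Hx.
destruct (Req_dec x 0) as [->|Hx0].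
  rewrite Rmult_0_r, sin_0; lra.
destruct (MVT_gen (fun y => sin (l * y) - l * sin y) 0 x
  (fun y => l * (cos (l * y) - cos y))) as [c [Hc Heq]].
- intros y _. auto_derive; [easy|ring].
- intros y _. apply continuity_pt_filterlim.
  apply (ex_derive_continuous (fun y => sin (l * y) - l * sin y)).
  auto_derive; easy.
- rewrite Rmin_left, Rmax_right in Hc by lra.
  rewrite Rmult_0_r, sin_0 in Heq.
  assert (cos c <= cos (l * c)) by (apply cos_decr_1; nra).
  assert (0 <= l * (cos (l * c) - cos c) * (x - 0)).
  { apply Rmult_le_pos; [apply Rmult_le_pos|]; lra. }
  lra.
Qed.

Lemma continuous_of_ex_derive (f : R -> R) :
  (forall x, ex_derive f x) -> forall x, continuous f x.
Proof. intros Hf x; apply (ex_derive_continuous f), Hf. Qed.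

Lemma RInt_lt_ex_derive (f g : R -> R) (a b : R) : a < b ->
  (forall x, ex_derive f x) -> (forall x, ex_derive g x) ->
  (forall x, a < x < b -> f x < g x) -> RInt f a b < RInt g a b.
Proof.
intros Hab Hf Hg Hlt.
apply RInt_lt; auto; intros; apply continuous_of_ex_derive; auto.
Qed.

Lemma ex_RInt_ex_derive (f : R -> R) (a b : R) :
  (forall x, ex_derive f x) -> ex_RInt f a b.
Proof.
intros Hf; apply (ex_RInt_continuous f); intros; apply continuous_of_ex_derive; auto.
Qed.

Lemma RInt_antiderivative (f F : R -> R) (a b : R) :
  (forall x, is_derive F x (f x)) -> (forall x, ex_derive f x) ->
  RInt f a b = F b - F a.
Proof.
intros HF Hf; apply is_RInt_unique, (is_RInt_derive F f); intros; auto.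
apply continuous_of_ex_derive; auto.
Qed.

(** * The functional on cones: dependence on the height and on the slant width *)

Definition slant_density (Rr K th : R) : R :=
  exp (-2 * (K * (Rr - th))) * sin th / (1 + K ^ 2).

Lemma ex_derive_slant_density (Rr K x : R) : ex_derive (slant_density Rr K) x.
Proof. unfold slant_density; auto_derive; nra. Qed.

Lemma R2_cone (Rr h t0 : R) : 0 <= t0 <= Rr ->
  R2_sym Rr (u_cone Rr h t0) =
  2 * PI * (exp (-2 * h) * (1 - cos t0)
            + RInt (slant_density Rr (h / (Rr - t0))) t0 Rr).
Proof.
intros Ht.
unfold R2_sym; f_equal.
apply is_RInt_unique.
(* The kink [t0] is an endpoint of both pieces, so the value of [Derive] there never enters. For
   [t0 = Rr] the quotient [h / 0] occurs only in an integral over a point. *)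
apply (is_RInt_Chasles _ 0 t0 Rr (exp (-2 * h) * (1 - cos t0))
  (RInt (slant_density Rr (h / (Rr - t0))) t0 Rr)).
- apply (is_RInt_ext (fun th => exp (-2 * h) * sin th)).
  + intros x Hx; rewrite Rmin_left, Rmax_right in Hx by lra.
    assert (Derive (u_cone Rr h t0) x = 0) as ->.
    { apply is_derive_unique, (is_derive_ext_loc (fun _ => h)).
      - exists (mkposreal (t0 - x) ltac:(lra)); intros y Hy.
        apply Rabs_def2 in Hy; simpl in Hy; unfold minus, plus, opp in Hy; simpl in Hy.
        unfold u_cone; destruct (Rle_dec y t0); lra.
      - auto_derive; easy. }
    unfold u_cone; destruct (Rle_dec x t0); [|lra].
    match goal with |- ?a = ?b => change (@eq R a b) end; field.
  + replace (exp (-2 * h) * (1 - cos t0))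
      with (minus (- exp (-2 * h) * cos t0) (- exp (-2 * h) * cos 0))
      by (rewrite cos_0; unfold minus, plus, opp; simpl; ring).
    apply (is_RInt_derive (fun th => - exp (-2 * h) * cos th)); intros x _.
    * auto_derive; [easy|ring].
    * apply continuous_of_ex_derive; intros; auto_derive; easy.
- apply (is_RInt_ext (slant_density Rr (h / (Rr - t0)))).
  + intros x Hx; rewrite Rmin_left, Rmax_right in Hx by lra.
    assert (Derive (u_cone Rr h t0) x = - (h / (Rr - t0))) as ->.
    { apply is_derive_unique,
        (is_derive_ext_loc (fun th => h / (Rr - t0) * (Rr - th))).
      - exists (mkposreal (x - t0) ltac:(lra)); intros y Hy.
        apply Rabs_def2 in Hy; simpl in Hy; unfold minus, plus, opp in Hy; simpl in Hy.
        unfold u_cone; destruct (Rle_dec y t0); lra.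
      - auto_derive; [easy|ring]. }
    unfold u_cone, slant_density; destruct (Rle_dec x t0); [lra|].
    f_equal; ring.
  + apply (RInt_correct (slant_density Rr (h / (Rr - t0)))).
    apply ex_RInt_ex_derive, ex_derive_slant_density.
Qed.

Lemma slant_density_decreasing (Rr K1 K2 th : R) : 0 < th < Rr -> Rr < PI ->
  0 <= K1 < K2 -> slant_density Rr K2 th < slant_density Rr K1 th.
Proof.
intros Hth HR HK; unfold slant_density, Rdiv.
assert (0 < sin th) by (apply sin_gt_0; lra).
assert (exp (-2 * (K2 * (Rr - th))) < exp (-2 * (K1 * (Rr - th)))).
{ apply exp_increasing; nra. }
assert (/ (1 + K2 ^ 2) < / (1 + K1 ^ 2)) by (apply Rinv_lt_contravar; nra).
assert (0 < / (1 + K2 ^ 2)) by (apply Rinv_0_lt_compat; nra).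
assert (0 < exp (-2 * (K2 * (Rr - th)))) by apply exp_pos.
apply Rmult_gt_0_lt_compat; nra.
Qed.

Lemma R2_cone_decreasing (Rr h1 h2 t0 : R) : 0 < Rr < PI -> 0 <= t0 <= Rr ->
  0 <= h1 < h2 -> R2_sym Rr (u_cone Rr h2 t0) < R2_sym Rr (u_cone Rr h1 t0).
Proof.
intros HR Ht Hh.
rewrite !R2_cone by lra.
assert (HPI := PI_RGT_0).
apply Rmult_lt_compat_l; [lra|].
assert (He : exp (-2 * h2) < exp (-2 * h1)) by (apply exp_increasing; lra).
assert (Hc := COS_bound t0).
(* For [t0 < Rr] strictness comes from the slant, since the cap term vanishes at [t0 = 0]. For
   [t0 = Rr] only the cap is left, and [cos Rr < 1]. *)
destruct (Rle_lt_or_eq_dec t0 Rr (proj2 Ht)) as [Hlt|Heq].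
- apply Rplus_le_lt_compat; [nra|].
  apply RInt_lt_ex_derive; try apply ex_derive_slant_density; auto.
  intros x Hx; apply slant_density_decreasing; try lra.
  unfold Rdiv; assert (0 < / (Rr - t0)) by (apply Rinv_0_lt_compat; lra).
  split; nra.
- rewrite Heq, !RInt_point; unfold zero; simpl.
  assert (cos Rr < cos 0) by (apply cos_decreasing_1; lra).
  rewrite cos_0 in *; nra.
Qed.

(* [g / (2 PI)] as a function of the slant width [L = Rr - t0]; this closed form is smooth on the whole line, including at the degenerate width [L = 0]. *)
Definition cone_value (Rr H L : R) : R :=
  exp (-2 * H) * (1 - cos (Rr - L)) +
  L ^ 3 / (L ^ 2 + H ^ 2) *
  ((2 * H * sin Rr - L * cos Rr)
   - exp (-2 * H) * (2 * H * sin (Rr - L) - L * cos (Rr - L))) / (L ^ 2 + 4 * H ^ 2).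

Lemma R2_cone_value (Rr H t0 : R) : 0 < H -> 0 <= t0 <= Rr ->
  R2_sym Rr (u_cone Rr H t0) = 2 * PI * cone_value Rr H (Rr - t0).
Proof.
intros HH Ht; rewrite R2_cone by lra; apply Rmult_eq_compat_l.
unfold cone_value; replace (Rr - (Rr - t0)) with t0 by ring; apply Rplus_eq_compat_l.
destruct (Rle_lt_or_eq_dec t0 Rr (proj2 Ht)) as [Hlt|Heq].
- set (K := H / (Rr - t0)).
  rewrite (RInt_antiderivative _
    (fun th => exp (-2 * (K * (Rr - th))) * (2 * K * sin th - cos th)
               / (1 + 4 * K ^ 2) / (1 + K ^ 2))).
  + replace (-2 * (K * (Rr - Rr))) with 0 by ring; rewrite exp_0.
    replace (-2 * (K * (Rr - t0))) with (-2 * H) by (unfold K; field; lra).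
    unfold K; field; repeat split; nra.
  + intros x; unfold slant_density; auto_derive; [repeat split; nra|].
    unfold Rminus; field; split; nra.
  + apply ex_derive_slant_density.
(* Width zero: the integral over a point is [0], and so is the other side through its factor
   [L ^ 3]. *)
- rewrite Heq, RInt_point; change (@zero _) with 0; field; nra.
Qed.

(** * The derivative in the slant width and its signs at both ends *)

(** Here [s = (Rr - th) / L], so that [K * (Rr - th)] becomes [H * s] and [L] leaves the
    exponential. *)
Definition slope_density (Rr H L s : R) : R :=
  2 * exp (-2 * H * s) * (L ^ 2 * s / H + L ^ 2 / (L ^ 2 + H ^ 2)) * sin (Rr - L * s).

(* The function [G(L)] above. *)
Definition slope (Rr H L : R) : R :=
  RInt (slope_density Rr H L) 0 1 - exp (-2 * H) * sin (Rr - L).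

Lemma ex_derive_slope_density (Rr H L x : R) : ex_derive (slope_density Rr H L) x.
Proof. unfold slope_density; auto_derive; easy. Qed.

(* Primitives in [s]: of [exp (-2 H s) sin (Rr - L s)], of its cosine analogue, and of [slope_density]. *)
Definition slope_prim_sin (Rr H L s : R) : R :=
  - exp (-2 * H * s) * (2 * H * sin (Rr - L * s) - L * cos (Rr - L * s))
  / (L ^ 2 + 4 * H ^ 2).

Definition slope_prim_cos (Rr H L s : R) : R :=
  - exp (-2 * H * s) * (2 * H * cos (Rr - L * s) + L * sin (Rr - L * s))
  / (L ^ 2 + 4 * H ^ 2).

Definition slope_prim (Rr H L s : R) : R :=
  2 * L ^ 2 / H * (s * slope_prim_sin Rr H L s
     + (2 * H * slope_prim_sin Rr H L s - L * slope_prim_cos Rr H L s)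
       / (L ^ 2 + 4 * H ^ 2))
  + 2 * L ^ 2 / (L ^ 2 + H ^ 2) * slope_prim_sin Rr H L s.

Lemma slope_closed_form (Rr H L : R) : 0 < H ->
  slope Rr H L = slope_prim Rr H L 1 - slope_prim Rr H L 0 - exp (-2 * H) * sin (Rr - L).
Proof.
intros HH; unfold slope; apply Rplus_eq_compat_r.
apply RInt_antiderivative; [|apply ex_derive_slope_density].
intros s; unfold slope_prim, slope_prim_sin, slope_prim_cos, slope_density.
auto_derive; [repeat split; nra|].
unfold Rminus; field; repeat split; nra.
Qed.

(** The identity is checked on closed forms, without differentiating under the integral. As
    [H ^ 2 / (L ^ 2 + H ^ 2)] is positive, [slope] carries the sign of the derivative. *)
Lemma is_derive_cone_value (Rr H L : R) : 0 < H ->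
  is_derive (cone_value Rr H) L (H ^ 2 / (L ^ 2 + H ^ 2) * slope Rr H L).
Proof.
intros HH; rewrite slope_closed_form by easy.
unfold cone_value, slope_prim, slope_prim_sin, slope_prim_cos.
auto_derive; [repeat split; nra|].
replace (-2 * H * 1) with (-2 * H) by ring.
replace (-2 * H * 0) with 0 by ring.
rewrite !Rmult_1_r, !Rmult_0_r, !Rminus_0_r, exp_0.
unfold Rminus.
field; repeat split; nra.
Qed.

Lemma slope_continuous (Rr H : R) : 0 < H -> continuity (slope Rr H).
Proof.
intros HH x; apply continuity_pt_filterlim.
apply (continuous_ext (fun L =>
  slope_prim Rr H L 1 - slope_prim Rr H L 0 - exp (-2 * H) * sin (Rr - L))).
  intros y; symmetry; apply slope_closed_form; easy.
apply continuous_of_ex_derive; intros L.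
unfold slope_prim, slope_prim_sin, slope_prim_cos.
auto_derive; repeat split; nra.
Qed.

Lemma slope_0_neg (Rr H : R) : 0 < Rr < PI -> 0 < H -> slope Rr H 0 < 0.
Proof.
intros HR HH; rewrite slope_closed_form by easy.
assert (forall s, slope_prim Rr H 0 s = 0) as Hz.
{ intros s; unfold slope_prim, Rdiv; ring. }
rewrite !Hz, !Rminus_0_r.
assert (0 < sin Rr) by (apply sin_gt_0; lra).
assert (0 < exp (-2 * H)) by apply exp_pos.
nra.
Qed.

Lemma slope_R_pos (Rr H : R) : 0 < Rr < PI -> 0 < H -> 0 < slope Rr H Rr.
Proof.
intros HR HH; unfold slope.
replace (Rr - Rr) with 0 by ring; rewrite sin_0, Rmult_0_r, Rminus_0_r.
apply RInt_gt_0; [lra| |intros; apply continuous_of_ex_derive, ex_derive_slope_density].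
intros s Hs; unfold slope_density.
assert (0 < Rr * s < Rr) by (split; nra).
assert (0 < sin (Rr - Rr * s)) by (apply sin_gt_0; lra).
assert (0 < exp (-2 * H * s)) by apply exp_pos.
assert (0 < Rr ^ 2 * s / H)
  by (apply Rdiv_lt_0_compat; [apply Rmult_lt_0_compat; nra|lra]).
assert (0 < Rr ^ 2 / (Rr ^ 2 + H ^ 2)) by (apply Rdiv_lt_0_compat; nra).
repeat apply Rmult_lt_0_compat; lra.
Qed.

(** * Single sign change where [Rr - L <= PI / 2] *)

(** Monotonicity in [L] of [sin (Rr - L * s) / sin (Rr - L)], cross-multiplied so as to allow
    [L2 = Rr], where the denominator vanishes. *)
Lemma sin_ratio_le (Rr L1 L2 s : R) : Rr < PI -> 0 < L1 < L2 -> L2 <= Rr ->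
  Rr - L1 <= PI / 2 -> 0 <= s <= 1 ->
  sin (Rr - L1 * s) * sin (Rr - L2) <= sin (Rr - L2 * s) * sin (Rr - L1).
Proof.
intros HR HL HL2 Hpi Hs; assert (HPI := PI_RGT_0).
destruct (Rle_lt_dec (PI / 2) (Rr - L2 * s)) as [Hge|Hlt].
- assert (sin (Rr - L1 * s) <= sin (Rr - L2 * s)) by (apply sin_decr_1; nra).
  assert (sin (Rr - L2) <= sin (Rr - L1)) by (apply sin_incr_1; lra).
  apply Rmult_le_compat; try easy; apply sin_ge_0; nra.
(* With products turned into cosines, the comparison reduces to [|L1 - L2 * s| <= L2 - L1 * s] for
   the differences and to [L1 + L2 * s <= L2 + L1 * s] for the sums. *)
- assert (Hp : forall a b, sin a * sin b = (cos (a - b) - cos (a + b)) / 2).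
  { intros a b; rewrite cos_minus, cos_plus; field. }
  rewrite !Hp.
  assert (cos (Rr - L1 * s - (Rr - L2)) <= cos (Rr - L2 * s - (Rr - L1))).
  { destruct (Rle_lt_dec 0 (Rr - L2 * s - (Rr - L1))).
    - apply cos_decr_1; nra.
    - rewrite <- (cos_neg (Rr - L2 * s - (Rr - L1))); apply cos_decr_1; nra. }
  assert (cos (Rr - L2 * s + (Rr - L1)) <= cos (Rr - L1 * s + (Rr - L2)))
    by (apply cos_decr_1; nra).
  lra.
Qed.

Lemma width_ratio_increasing (H L1 L2 : R) : 0 < H -> 0 < L1 < L2 ->
  L1 ^ 2 / (L1 ^ 2 + H ^ 2) < L2 ^ 2 / (L2 ^ 2 + H ^ 2).
Proof.
intros HH HL.
assert (0 < (L2 ^ 2 - L1 ^ 2) * H ^ 2 / ((L1 ^ 2 + H ^ 2) * (L2 ^ 2 + H ^ 2))).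
{ apply Rdiv_lt_0_compat; [apply Rmult_lt_0_compat|apply Rmult_lt_0_compat]; nra. }
replace (L2 ^ 2 / (L2 ^ 2 + H ^ 2)) with
  (L1 ^ 2 / (L1 ^ 2 + H ^ 2)
   + (L2 ^ 2 - L1 ^ 2) * H ^ 2 / ((L1 ^ 2 + H ^ 2) * (L2 ^ 2 + H ^ 2)))
  by (field; split; nra).
lra.
Qed.

(** Cross-multiplied form of the growth of [G / sin (Rr - L)]: the terms [exp (-2 * H) * sin (Rr -
    L1) * sin (Rr - L2)] on the two sides cancel, so only the integrals have to be compared. *)
Lemma slope_crossing_upper (Rr H L1 L2 : R) : Rr < PI -> 0 < H -> 0 < L1 < L2 ->
  L2 <= Rr -> Rr - L1 <= PI / 2 -> 0 <= slope Rr H L1 -> 0 < slope Rr H L2.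
Proof.
intros HR HH HL HL2 Hpi Hs1; assert (HPI := PI_RGT_0).
assert (Hp1 : 0 < sin (Rr - L1)) by (apply sin_gt_0; lra).
assert (Hp2 : 0 <= sin (Rr - L2)) by (apply sin_ge_0; lra).
assert (RInt (fun s => sin (Rr - L2) * slope_density Rr H L1 s) 0 1
        < RInt (fun s => sin (Rr - L1) * slope_density Rr H L2 s) 0 1) as Hlt.
{ apply RInt_lt_ex_derive; [lra| | |].
  - intros x; unfold slope_density; auto_derive; easy.
  - intros x; unfold slope_density; auto_derive; easy.
  - intros s Hs; unfold slope_density.
    assert (Hr := sin_ratio_le Rr L1 L2 s HR HL HL2 Hpi ltac:(lra)).
    assert (He : 0 < exp (-2 * H * s)) by apply exp_pos.
    assert (Hw := width_ratio_increasing H L1 L2 HH HL).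
    assert (L1 ^ 2 * s / H < L2 ^ 2 * s / H).
    { unfold Rdiv; apply Rmult_lt_compat_r; [apply Rinv_0_lt_compat; lra|].
      apply Rmult_lt_compat_r; nra. }
    assert (0 < L1 ^ 2 * s / H)
      by (apply Rdiv_lt_0_compat; [apply Rmult_lt_0_compat; nra|lra]).
    assert (0 < L1 ^ 2 / (L1 ^ 2 + H ^ 2)) by (apply Rdiv_lt_0_compat; nra).
    assert (0 < L2 * s < L2) by (split; nra).
    assert (0 < sin (Rr - L2 * s)) by (apply sin_gt_0; lra).
    set (w1 := L1 ^ 2 * s / H + L1 ^ 2 / (L1 ^ 2 + H ^ 2)).
    set (w2 := L2 ^ 2 * s / H + L2 ^ 2 / (L2 ^ 2 + H ^ 2)).
    assert (0 < w1 < w2) by (unfold w1, w2; lra).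
    (* The sine ratio gives a weak inequality; strictness comes from the weights, [w1 < w2]. *)
    apply Rle_lt_trans with
      (2 * exp (-2 * H * s) * (w1 * (sin (Rr - L2 * s) * sin (Rr - L1)))).
    + replace (sin (Rr - L2) * (2 * exp (-2 * H * s) * w1 * sin (Rr - L1 * s)))
        with (2 * exp (-2 * H * s) * (w1 * (sin (Rr - L1 * s) * sin (Rr - L2)))) by ring.
      apply Rmult_le_compat_l; [lra|apply Rmult_le_compat_l; lra].
    + replace (sin (Rr - L1) * (2 * exp (-2 * H * s) * w2 * sin (Rr - L2 * s)))
        with (2 * exp (-2 * H * s) * (w2 * (sin (Rr - L2 * s) * sin (Rr - L1)))) by ring.
      apply Rmult_lt_compat_l; [lra|apply Rmult_lt_compat_r; nra]. }
assert (Hscal : forall c L, RInt (fun s => c * slope_density Rr H L s) 0 1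
                            = c * RInt (slope_density Rr H L) 0 1).
{ intros c L; apply (RInt_scal (slope_density Rr H L)).
  apply ex_RInt_ex_derive, ex_derive_slope_density. }
rewrite !Hscal in Hlt.
unfold slope in *.
set (I1 := RInt (slope_density Rr H L1) 0 1) in *.
set (I2 := RInt (slope_density Rr H L2) 0 1) in *.
assert (0 <= sin (Rr - L2) * (I1 - exp (-2 * H) * sin (Rr - L1)))
  by (apply Rmult_le_pos; easy).
apply Rmult_lt_reg_l with (sin (Rr - L1)); [easy|].
nra.
Qed.

(** * Single sign change where [Rr - L >= PI / 2] *)

(** With [m] the mean and [d] half the difference of the widths, the right side is
    [- 2 * cos (Rr - m * s) * sin (s * d)]. For [s <= 1] this cosine is at most [cos (Rr - m) <= 0],
    and [sin (s * d) >= s * sin d] by concavity. *)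
Lemma sin_chord_le (Rr L1 L2 s : R) : Rr < PI -> 0 < L1 < L2 -> L2 <= Rr ->
  PI / 2 <= Rr - L2 -> 0 <= s <= 1 ->
  s * (sin (Rr - L2) - sin (Rr - L1)) <= sin (Rr - L2 * s) - sin (Rr - L1 * s).
Proof.
intros HR HL HL2 Hpi Hs; assert (HPI := PI_RGT_0).
rewrite !form4.
replace ((Rr - L2 + (Rr - L1)) / 2) with (Rr - (L1 + L2) / 2) by field.
replace ((Rr - L2 - (Rr - L1)) / 2) with (- ((L2 - L1) / 2)) by field.
replace ((Rr - L2 * s + (Rr - L1 * s)) / 2) with (Rr - (L1 + L2) / 2 * s) by field.
replace ((Rr - L2 * s - (Rr - L1 * s)) / 2) with (- (s * ((L2 - L1) / 2))) by field.
rewrite !sin_neg.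
assert (s * sin ((L2 - L1) / 2) <= sin (s * ((L2 - L1) / 2)))
  by (apply sin_scale_ge; lra).
assert (0 <= sin ((L2 - L1) / 2)) by (apply sin_ge_0; lra).
assert (cos (Rr - (L1 + L2) / 2 * s) <= cos (Rr - (L1 + L2) / 2))
  by (apply cos_decr_1; nra).
assert (cos (Rr - (L1 + L2) / 2) <= 0) by (apply cos_le_0; nra).
assert (- cos (Rr - (L1 + L2) / 2) * (s * sin ((L2 - L1) / 2))
        <= - cos (Rr - (L1 + L2) / 2 * s) * sin (s * ((L2 - L1) / 2))).
{ apply Rmult_le_compat; try lra. apply Rmult_le_pos; lra. }
lra.
Qed.

(** Already [sin (Rr - L) / L] is nonincreasing: reflect to [y = PI - (Rr - L2)] and combine
    concavity with [l * y <= PI - (Rr - L1) <= PI / 2]. The second factor [l < 1] only helps. *)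
Lemma sin_over_square_decreasing (Rr L1 L2 : R) : Rr < PI -> 0 < L1 < L2 -> L2 <= Rr ->
  PI / 2 <= Rr - L2 -> sin (Rr - L2) / L2 ^ 2 <= sin (Rr - L1) / L1 ^ 2.
Proof.
intros HR HL HL2 Hpi; assert (HPI := PI_RGT_0).
set (l := L1 / L2).
assert (HlL : l * L2 = L1) by (unfold l; field; lra).
assert (Hl : 0 < l < 1).
{ split; [apply Rdiv_lt_0_compat; lra|nra]. }
clearbody l.
assert (Hsc : l * sin (PI - (Rr - L2)) <= sin (l * (PI - (Rr - L2))))
  by (apply sin_scale_ge; lra).
assert (sin (l * (PI - (Rr - L2))) <= sin (PI - (Rr - L1))).
{ apply sin_incr_1; nra. }
rewrite !sin_PI_x in *.
assert (0 <= sin (Rr - L2)) by (apply sin_ge_0; lra).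
rewrite <- HlL.
replace (sin (Rr - L2) / L2 ^ 2) with (l ^ 2 * sin (Rr - L2) / (l * L2) ^ 2)
  by (field; lra).
rewrite HlL; unfold Rdiv; apply Rmult_le_compat_r.
  apply Rlt_le, Rinv_0_lt_compat; nra.
assert (0 <= (1 - l) * (l * sin (Rr - L2))) by (repeat apply Rmult_le_pos; lra).
lra.
Qed.

(** The integrand of the integral in [(1 + H ^ 2 / L ^ 2) * G(L)]. The rescaling turns the second
    summand of the weight into the constant [1]. *)
Definition scaled_slope_density (Rr H L s : R) : R :=
  2 * exp (-2 * H * s) * (s * (L ^ 2 + H ^ 2) / H + 1) * sin (Rr - L * s).

Lemma ex_derive_scaled_slope_density (Rr H L x : R) : ex_derive (scaled_slope_density Rr H L) x.
Proof. unfold scaled_slope_density; auto_derive; easy. Qed.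

Lemma slope_rescale (Rr H L : R) : 0 < H -> 0 < L ->
  (L ^ 2 + H ^ 2) / L ^ 2 * slope Rr H L =
  RInt (scaled_slope_density Rr H L) 0 1
  - exp (-2 * H) * (sin (Rr - L) + H ^ 2 * (sin (Rr - L) / L ^ 2)).
Proof.
intros HH HL; unfold slope.
assert (RInt (scaled_slope_density Rr H L) 0 1
        = (L ^ 2 + H ^ 2) / L ^ 2 * RInt (slope_density Rr H L) 0 1) as ->.
{ rewrite <- (RInt_scal (slope_density Rr H L))
    by apply ex_RInt_ex_derive, ex_derive_slope_density.
  apply RInt_ext; intros s _; unfold scaled_slope_density, slope_density, scal; simpl.
  unfold mult; simpl; field; repeat split; nra. }
field; lra.
Qed.

Lemma slope_crossing_lower (Rr H L1 L2 : R) : Rr < PI -> 0 < H -> 0 < L1 < L2 ->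
  L2 <= Rr -> PI / 2 <= Rr - L2 -> 0 <= slope Rr H L1 -> 0 < slope Rr H L2.
Proof.
intros HR HH HL HL2 Hpi Hs1; assert (HPI := PI_RGT_0).
set (D := sin (Rr - L2) - sin (Rr - L1)).
assert (HD : 0 <= D).
{ unfold D; assert (sin (Rr - L1) <= sin (Rr - L2)) by (apply sin_decr_1; lra); lra. }
(* The added [2 * exp (-2 * H) * D * s] integrates to [exp (-2 * H) * D], exactly the growth of
   [exp (-2 * H) * sin (Rr - L)] from [L1] to [L2]. The other boundary term, with
   [sin (Rr - L) / L ^ 2], moves in the favourable direction. *)
assert (RInt (fun s => scaled_slope_density Rr H L1 s + 2 * exp (-2 * H) * D * s) 0 1
        < RInt (scaled_slope_density Rr H L2) 0 1) as Hlt.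
{ apply RInt_lt_ex_derive; [lra| |apply ex_derive_scaled_slope_density|].
  - intros x; unfold scaled_slope_density; auto_derive; easy.
  - intros s Hs; unfold scaled_slope_density.
    assert (Hc := sin_chord_le Rr L1 L2 s HR HL HL2 Hpi ltac:(lra)); fold D in Hc.
    assert (He0 : 0 < exp (-2 * H)) by apply exp_pos.
    assert (He : exp (-2 * H) < exp (-2 * H * s)) by (apply exp_increasing; nra).
    set (v1 := s * (L1 ^ 2 + H ^ 2) / H).
    set (v2 := s * (L2 ^ 2 + H ^ 2) / H).
    assert (Hv : 0 < v1 < v2).
    { unfold v1, v2, Rdiv; assert (0 < / H) by (apply Rinv_0_lt_compat; lra); split.
      - apply Rmult_lt_0_compat; [apply Rmult_lt_0_compat|]; nra.
      - apply Rmult_lt_compat_r; [easy|apply Rmult_lt_compat_l; nra]. }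
    set (S1 := sin (Rr - L1 * s)) in *; set (S2 := sin (Rr - L2 * s)) in *.
    assert (0 < L1 * s < L1) by (split; nra).
    assert (HS1 : 0 < S1) by (apply sin_gt_0; lra).
    assert (0 <= s * D) by nra.
    assert (v1 * S1 < v2 * S2).
    { apply Rlt_le_trans with (v2 * S1);
        [apply Rmult_lt_compat_r|apply Rmult_le_compat_l]; lra. }
    set (E0 := exp (-2 * H)) in *; set (E := exp (-2 * H * s)) in *.
    (* The summand [1] of the weight pays for the added term, by the chord bound and [E0 < E]. *)
    assert (E0 * (s * D) <= E * (S2 - S1)) by (apply Rmult_le_compat; lra).
    assert (E * (v1 * S1) < E * (v2 * S2)) by (apply Rmult_lt_compat_l; lra).
    nra. }
rewrite (RInt_plus (scaled_slope_density Rr H L1) (fun s => 2 * exp (-2 * H) * D * s)) in Hlt;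
  [|apply ex_RInt_ex_derive, ex_derive_scaled_slope_density
   |apply ex_RInt_ex_derive; intros; auto_derive; easy].
rewrite (RInt_antiderivative (fun s => 2 * exp (-2 * H) * D * s)
           (fun s => exp (-2 * H) * D * s ^ 2)) in Hlt;
  [|intros; auto_derive; [easy|ring]|intros; auto_derive; easy].
unfold plus in Hlt; simpl in Hlt.
assert (H1 := slope_rescale Rr H L1 HH ltac:(lra)).
assert (H2 := slope_rescale Rr H L2 HH ltac:(lra)).
assert (Hq := sin_over_square_decreasing Rr L1 L2 HR HL HL2 Hpi).
assert (0 < (L1 ^ 2 + H ^ 2) / L1 ^ 2) by (apply Rdiv_lt_0_compat; nra).
assert (0 < (L2 ^ 2 + H ^ 2) / L2 ^ 2) by (apply Rdiv_lt_0_compat; nra).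
assert (0 <= (L1 ^ 2 + H ^ 2) / L1 ^ 2 * slope Rr H L1) by (apply Rmult_le_pos; lra).
assert (He0 : 0 < exp (-2 * H)) by apply exp_pos.
assert (exp (-2 * H) * (H ^ 2 * (sin (Rr - L2) / L2 ^ 2))
        <= exp (-2 * H) * (H ^ 2 * (sin (Rr - L1) / L1 ^ 2))).
{ apply Rmult_le_compat_l; [lra|apply Rmult_le_compat_l; nra]. }
apply Rmult_lt_reg_l with ((L2 ^ 2 + H ^ 2) / L2 ^ 2); [easy|].
rewrite Rmult_0_r, H2; unfold D in *; lra.
Qed.

(** * The unique zero of [G] and the strict minimum of the cone value *)

Lemma slope_crossing (Rr H L1 L2 : R) : 0 < Rr < PI -> 0 < H -> 0 < L1 < L2 ->
  L2 <= Rr -> 0 <= slope Rr H L1 -> 0 < slope Rr H L2.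
Proof.
intros HR HH HL HL2 Hs.
destruct (Rle_lt_dec (Rr - L1) (PI / 2)) as [H1|H1].
  apply (slope_crossing_upper Rr H L1 L2); lra.
destruct (Rle_lt_dec (PI / 2) (Rr - L2)) as [H2|H2].
  apply (slope_crossing_lower Rr H L1 L2); lra.
assert (HPI := PI_RGT_0).
(* The widths lie on either side of [Rr - PI / 2], so the sign is carried through that width. *)
apply (slope_crossing_upper Rr H (Rr - PI / 2) L2); try lra.
apply Rlt_le, (slope_crossing_lower Rr H L1 (Rr - PI / 2)); lra.
Qed.

Lemma slope_root (Rr H : R) : 0 < Rr < PI -> 0 < H ->
  exists Ls, 0 < Ls < Rr /\ slope Rr H Ls = 0 /\
    (forall L, 0 <= L < Ls -> slope Rr H L < 0) /\
    (forall L, Ls < L <= Rr -> 0 < slope Rr H L).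
Proof.
intros HR HH.
assert (H0 := slope_0_neg Rr H HR HH).
assert (H1 := slope_R_pos Rr H HR HH).
destruct (IVT (slope Rr H) 0 Rr (slope_continuous Rr H HH)) as [Ls [HLs Hz]]; try lra.
assert (Ls <> 0) by (intros ->; lra).
assert (Ls <> Rr) by (intros ->; lra).
exists Ls; repeat split; try lra.
(* A nonnegative value before [Ls] would force a positive one at [Ls]. Width [0] is treated apart
   because [slope_crossing] needs [0 < L1]. *)
- intros L HL; destruct (Req_dec L 0) as [->|HL0]; [lra|].
  apply Rnot_le_lt; intros Hle.
  assert (0 < slope Rr H Ls) by (apply (slope_crossing Rr H L Ls); lra); lra.
- intros L HL; apply (slope_crossing Rr H Ls L); lra.
Qed.

Lemma cone_value_min (Rr H Ls : R) : 0 < Rr < PI -> 0 < H -> 0 < Ls < Rr ->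
  (forall L, 0 <= L < Ls -> slope Rr H L < 0) ->
  (forall L, Ls < L <= Rr -> 0 < slope Rr H L) ->
  forall L, 0 <= L <= Rr -> L <> Ls -> cone_value Rr H Ls < cone_value Rr H L.
Proof.
intros HR HH HLs Hneg Hpos L HL Hne.
assert (Hfac : forall c, 0 < H ^ 2 / (c ^ 2 + H ^ 2)).
{ intros c; apply Rdiv_lt_0_compat; nra. }
destruct (Rtotal_order L Ls) as [Hlt|[Heq|Hgt]]; [|easy|].
- destruct (MVT_cor2 (cone_value Rr H)
    (fun L => H ^ 2 / (L ^ 2 + H ^ 2) * slope Rr H L) L Ls Hlt) as [c [Hc Hcb]].
    intros x _; apply is_derive_Reals, is_derive_cone_value; easy.
  assert (Hn := Hneg c ltac:(lra)); assert (Hf := Hfac c).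
  assert (H ^ 2 / (c ^ 2 + H ^ 2) * slope Rr H c < 0) by nra.
  nra.
- destruct (MVT_cor2 (cone_value Rr H)
    (fun L => H ^ 2 / (L ^ 2 + H ^ 2) * slope Rr H L) Ls L Hgt) as [c [Hc Hcb]].
    intros x _; apply is_derive_Reals, is_derive_cone_value; easy.
  assert (Hn := Hpos c ltac:(lra)); assert (Hf := Hfac c).
  assert (0 < H ^ 2 / (c ^ 2 + H ^ 2) * slope Rr H c) by nra.
  nra.
Qed.

(** * The critical point and the minimum over all cones *)

Lemma is_derive_g_fun (Rr H t : R) : 0 < H -> 0 < t < Rr ->
  is_derive (g_fun Rr H) t
    (- (2 * PI * (H ^ 2 / ((Rr - t) ^ 2 + H ^ 2) * slope Rr H (Rr - t)))).
Proof.
intros HH Ht.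
apply (is_derive_ext_loc (fun t => 2 * PI * cone_value Rr H (Rr - t))).
(* This radius keeps [y] inside [[0, Rr]], where the closed form equals the functional. *)
- assert (Hm : 0 < Rmin t (Rr - t)) by (apply Rmin_pos; lra).
  exists (mkposreal _ Hm); intros y Hy.
  apply Rabs_def2 in Hy; simpl in Hy; unfold minus, plus, opp in Hy; simpl in Hy.
  assert (Hl := Rmin_l t (Rr - t)); assert (Hr := Rmin_r t (Rr - t)).
  symmetry; apply R2_cone_value; lra.
- assert (Hd := is_derive_cone_value Rr H (Rr - t) HH).
  auto_derive; [eexists; apply Hd|].
  change (Derive (fun L : R => cone_value Rr H L) (Rr + - t))
    with (Derive (cone_value Rr H) (Rr - t)).
  rewrite (is_derive_unique _ _ _ Hd); ring.
Qed.

Theorem mainTheorem10 (H Rr : R) (hH : 0 < H) (hR0 : 0 < Rr) (hRpi : Rr < PI) :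
  exists ts : R,
    0 < ts < Rr /\
    is_derive (g_fun Rr H) ts 0 /\
    (forall t, 0 < t < Rr -> is_derive (g_fun Rr H) t 0 -> t = ts) /\
    (forall h t0, 0 <= h <= H -> 0 <= t0 <= Rr ->
       R2_sym Rr (u_cone Rr H ts) <= R2_sym Rr (u_cone Rr h t0)) /\
    (forall h t0, 0 <= h <= H -> 0 <= t0 <= Rr ->
       R2_sym Rr (u_cone Rr h t0) = R2_sym Rr (u_cone Rr H ts) -> h = H /\ t0 = ts).
Proof.
destruct (slope_root Rr H ltac:(lra) hH) as [Ls [HLs [Hz [Hneg Hpos]]]].
assert (HPI := PI_RGT_0).
(* Strict inequality away from the candidate point yields both the minimum and its uniqueness. *)
assert (Hmin : forall h t0, 0 <= h <= H -> 0 <= t0 <= Rr -> ~ (h = H /\ t0 = Rr - Ls) ->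
  R2_sym Rr (u_cone Rr H (Rr - Ls)) < R2_sym Rr (u_cone Rr h t0)).
{ intros h t0 Hh Ht Hne.
  assert (Hv : t0 <> Rr - Ls ->
    R2_sym Rr (u_cone Rr H (Rr - Ls)) < R2_sym Rr (u_cone Rr H t0)).
  { intros Ht0; rewrite !R2_cone_value by lra.
    apply Rmult_lt_compat_l; [lra|].
    replace (Rr - (Rr - Ls)) with Ls by ring.
    apply (cone_value_min Rr H Ls); auto; lra. }
  destruct (Req_dec h H) as [->|Hh'].
    apply Hv; tauto.
  (* Compare through the cone of full height [H] with the same [t0]. *)
  apply Rle_lt_trans with (R2_sym Rr (u_cone Rr H t0)).
  - destruct (Req_dec t0 (Rr - Ls)) as [->|Ht0]; [lra|].
    apply Rlt_le, Hv, Ht0.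
  - apply R2_cone_decreasing; lra. }
exists (Rr - Ls); split; [lra|split; [|split; [|split]]].
- assert (Hd := is_derive_g_fun Rr H (Rr - Ls) hH ltac:(lra)).
  replace (Rr - (Rr - Ls)) with Ls in Hd by ring.
  rewrite Hz in Hd.
  replace 0 with (- (2 * PI * (H ^ 2 / (Ls ^ 2 + H ^ 2) * 0))) by ring.
  exact Hd.
- intros t Ht Hd0.
  assert (Hd := is_derive_g_fun Rr H t hH Ht).
  apply is_derive_unique in Hd; apply is_derive_unique in Hd0.
  rewrite Hd0 in Hd.
  assert (0 < H ^ 2 / ((Rr - t) ^ 2 + H ^ 2)) by (apply Rdiv_lt_0_compat; nra).
  assert (0 < 2 * PI * (H ^ 2 / ((Rr - t) ^ 2 + H ^ 2))) by nra.
  assert (slope Rr H (Rr - t) = 0) by nra.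
  destruct (Rtotal_order (Rr - t) Ls) as [Hlt|[Heq|Hgt]]; [|lra|].
  + assert (slope Rr H (Rr - t) < 0) by (apply Hneg; lra); lra.
  + assert (0 < slope Rr H (Rr - t)) by (apply Hpos; lra); lra.
- intros h t0 Hh Ht.
  destruct (Req_dec h H) as [->|Hh']; [destruct (Req_dec t0 (Rr - Ls)) as [->|Ht0]|].
  + lra.
  + apply Rlt_le, Hmin; tauto.
  + apply Rlt_le, Hmin; tauto.
- intros h t0 Hh Ht Heq.
  destruct (Req_dec h H) as [Hh'|Hh']; [destruct (Req_dec t0 (Rr - Ls)) as [Ht0|Ht0]|].
  + tauto.
  + assert (Hm := Hmin h t0 Hh Ht ltac:(tauto)); lra.
  + assert (Hm := Hmin h t0 Hh Ht ltac:(tauto)); lra.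
Qed.
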